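(* There is a constant $c>0$ such that for every integer $n\ge 1$, with $N=2^n$, the $2N\times 2N$ unitary matrix $C_N^{\mathrm I}\oplus i\,S_N^{\mathrm I}$ can be realized exactly by a quantum circuit on $n+1$ qubits (plus at most a constant number of ancilla qubits that start and end in $|0\rangle$) consisting of at most $c\,n^2=c\log_2^2 N$ elementary gates. In short, $C_N^{\mathrm I}$ and $S_N^{\mathrm I}$ can be realized with $O(\log^2 N)$ elementary quantum gates.
   Context: Qubit/basis conventions: the state space of $m$ qubits is $\mathbb{C}^{2^m}$ with computational basis $|x\rangle$, $x$ a bit string $b_m\dots b_1$ identified with the integer $\sum_k b_k2^{k-1}$; the most significant bit corresponds to the leftmost tensor factor. A matrix of size $2^m\times 2^m$ acts on this basis indexed by these integers. Elementary gates: (i) a CNOT between any two qubits (negate the target bit iff the control bit is 1), and (ii) any single-qubit gate, i.e. $I_{2^{m-t}}\otimes U\otimes I_{2^{t-1}}$ with $U\in\mathcal U(2)$ arbitrary, acting on qubit $t$. A circuit realizes a unitary $W$ if the product of its gates equals $W$ (on the ancillas, if any, it maps $|0\rangle$ to $|0\rangle$). Direct sum $A\oplus B$ means the block-diagonal matrix $\begin{pmatrix}A&0\\0&B\end{pmatrix}$. Discrete Cosine and Sine transforms of type I: with $k_0=k_N=1/\sqrt2$ and $k_j=1$ for $0<j<N$, $C_N^{\mathrm I}=\sqrt{2/N}\,[k_ik_j\cos(ij\pi/N)]_{i,j=0,\dots,N}$ (size $(N+1)\times(N+1)$) and $S_N^{\mathrm I}=\sqrt{2/N}\,[\sin(ij\pi/N)]_{i,j=1,\dots,N-1}$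 (size $(N-1)\times(N-1)$). Here $i$ in $i\,S_N^{\mathrm I}$ denotes $\sqrt{-1}$. *)

(* Defs.v *)
From mathcomp Require Import all_boot all_algebra all_reals.
From mathcomp Require Import complex.
From mathcomp Require Import trigo.
Set Implicit Arguments. Unset Strict Implicit. Unset Printing Implicit Defensive.
Import GRing.Theory Num.Theory.
Local Open Scope ring_scope.
Local Open Scope complex_scope.

Section QC.
Variable R : realType.
Notation C := (R[i]).

(* bit number t (0-based, t = 0 is least significant) of the integer x;
   the paper's qubit t (1-based) is bit t-1 here. *)
Definition bit (t x : nat) : bool := odd (x %/ 2 ^ t).

Definition adjmx (m : nat) (U : 'M[C]_m) : 'M[C]_m := (map_mx conjc U)^T.
Definition unitary (m : nat) (U : 'M[C]_m) : Prop := U *m adjmx U = 1%:M.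

Inductive gate (m : nat) : Type :=
| CNOT of 'I_m & 'I_m             (* control, target *)
| Single of 'I_m & 'M[C]_2.

Definition valid_gate (m : nat) (g : gate m) : Prop :=
  match g with
  | CNOT c t => c <> t
  | Single _ U => unitary U
  end.

Definition b2I (b : bool) : 'I_2 := @inord 1 (nat_of_bool b).

(* matrix of a gate acting on the computational basis indexed by 'I_(2^m):
   entry (x, y) = <x| G |y>. *)
Definition gate_mx (m : nat) (g : gate m) : 'M[C]_(2 ^ m) :=
  match g with
  | CNOT c t => \matrix_(x, y)
      (if [forall k : 'I_m, (k != t) ==> (bit k x == bit k y)]
          && (bit t x == (bit t y (+) bit c y)) then 1 else 0)
  | Single t U => \matrix_(x, y)
      (* I_{2^(m-t)} (x) U (x) I_{2^(t-1)} *)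
      (if [forall k : 'I_m, (k != t) ==> (bit k x == bit k y)]
       then U (b2I (bit t x)) (b2I (bit t y)) else 0)
  end.

(* the circuit [g1; ...; gk] (g1 applied first) realizes gk * ... * g1 *)
Definition circuit_mx (m : nat) (gs : seq (gate m)) : 'M[C]_(2 ^ m) :=
  foldr (fun g M => M *m gate_mx g) 1%:M gs.

Lemma pow_widen (k a : nat) : (2 ^ k <= 2 ^ (k + a))%N.
Proof. by rewrite expnD leq_pmulr // expn_gt0. Qed.

(* G on k + a qubits (the a most significant qubits being ancillas) realizes
   W on k qubits: G (|0..0> (x) |y>) = |0..0> (x) W|y> for every basis state y. *)
Definition realizes (k a : nat) (W : 'M[C]_(2 ^ k)) (G : 'M[C]_(2 ^ (k + a)))
  : Prop :=
  forall (j : 'I_(2 ^ k)),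
    (forall i : 'I_(2 ^ k),
        G (widen_ord (pow_widen k a) i) (widen_ord (pow_widen k a) j) = W i j)
    /\ (forall x : 'I_(2 ^ (k + a)), (2 ^ k <= x)%N ->
        G x (widen_ord (pow_widen k a) j) = 0).

Definition kI (N i : nat) : R :=
  if (i == 0)%N || (i == N) then (Num.sqrt 2)^-1 else 1.

Definition DCT1 (N : nat) : 'M[R]_(N.+1) :=
  \matrix_(i, j) (Num.sqrt (2 / N%:R) * kI N i * kI N j
                   * cos ((i * j)%N%:R * pi / N%:R)).

(* rows/columns i, j = 1..N-1 are stored at indices i-1, j-1 *)
Definition DST1 (N : nat) : 'M[R]_(N.-1) :=
  \matrix_(i, j) (Num.sqrt (2 / N%:R)
                   * sin ((i.+1 * j.+1)%N%:R * pi / N%:R)).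

Definition cmx (m : nat) (A : 'M[R]_m) : 'M[C]_m := map_mx (fun x => x%:C) A.

Lemma dsum_dim (n : nat) : ((2 ^ n).+1 + (2 ^ n).-1 = 2 ^ n.+1)%N.
Proof.
by rewrite expnS mul2n -addnn addSn -addnS prednK // expn_gt0.
Qed.

Definition DCT_DST (n : nat) : 'M[C]_(2 ^ n.+1) :=
  castmx (dsum_dim n, dsum_dim n)
    (block_mx (cmx (DCT1 (2 ^ n))) 0 0 ('i *: cmx (DST1 (2 ^ n)))).

End QC.

(* Main.v *)
(* With N = 2^n and F the Fourier transform of Z/2N, the direct sum of C_N and i S_N
   is T^* F T, where T maps
   e_0, e_N to themselves and e_j, e_(N+j) to (e_j +- e_(2N-j)) / sqrt 2 for 0 < j < N.
   Splitting off the top qubit t of the index, T first applies a Hadamard gate to t unless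
   the low bits x vanish, then replaces x by -x mod N when t = 1; both factors are
   involutions. F is a circuit of O(n^2) gates. Conjugating phase gates by smaller Fourier
   transforms yields (controlled) additions of constants, hence the controlled negation of x,
   and the test x = 0 is the borrow that appears in one ancilla when 1 is subtracted from x.

   Circuits are interpreted as operators on amplitude functions psi : {0,1}^m -> C, so that a
   single gate involves a sum over one bit only. *)
Require Import Defs.
From Stdlib Require List.
From mathcomp Require Import all_boot all_algebra all_reals.
From mathcomp Require Import boolp complex.
From mathcomp Require Import trigo.
From mathcomp Require Import ring lra zify.
Set Implicit Arguments. Unset Strict Implicit. Unset Printing Implicit Defensive.
Import GRing.Theory Num.Theory.
Local Open Scope ring_scope.
Local Open Scope complex_scope.

(** * Complex exponentials *)

Section Expi.
Variable R : realType.

(* Angles are measured in turns, so that [expi] has period 1. *)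
Definition expi (t : R) : R[i] := cos (2 * pi * t) +i* sin (2 * pi * t).

Lemma expi0 : expi 0 = 1.
Proof. by rewrite /expi mulr0 cos0 sin0. Qed.

Lemma expiD (s t : R) : expi (s + t) = expi s * expi t.
Proof. by rewrite /expi mulrDr cosD sinD; simpc; rewrite [X in _ +i* X]addrC. Qed.

Lemma expi_half : expi (1 / 2) = -1.
Proof.
rewrite /expi (_ : 2 * pi * _ = pi); last by field.
by rewrite cospi sinpi; apply/eqP; rewrite eq_complex /= oppr0 !eqxx.
Qed.

Lemma expi_nat (n : nat) : expi n%:R = 1.
Proof.
elim: n => [|n IHn]; first exact: expi0.
rewrite -natr1 expiD IHn mul1r (_ : 1 = 1 / 2 + 1 / 2) ?expiD ?expi_half ?mulrNN ?mulr1 //.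
by field.
Qed.

Lemma expiDn (t : R) (n : nat) : expi (t + n%:R) = expi t.
Proof. by rewrite expiD expi_nat mulr1. Qed.

(** Reducing a register value modulo [M] inside a Fourier phase only discards whole turns. *)
Lemma expi_mod (a b M : nat) : (0 < M)%N ->
  expi (a%:R * (b %% M)%N%:R / M%:R) = expi (a%:R * b%:R / M%:R).
Proof.
move=> M_gt0; rewrite {2}(divn_eq b M) natrD natrM.
rewrite -(expiDn _ (a * (b %/ M))); congr expi; rewrite natrM; field.
by rewrite pnatr_eq0; lia.
Qed.

Lemma expi_half_nat (n : nat) : expi (n%:R / 2) = (-1) ^+ n.
Proof.
elim: n => [|n IHn]; first by rewrite mul0r expi0.
by rewrite -natr1 mulrDl expiD IHn expi_half exprSr.
Qed.

Lemma conj_expi (t : R) : conjc (expi t) = expi (- t).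
Proof. by rewrite /expi /= mulrN cosN sinN. Qed.

Lemma mul_expiN (t : R) : expi t * expi (- t) = 1.
Proof. by rewrite -expiD subrr expi0. Qed.

Lemma expi_addN (t : R) : expi t + expi (- t) = 2 * (cos (2 * pi * t))%:C.
Proof.
apply/eqP; rewrite eq_complex /expi mulrN cosN sinN /=; apply/andP.
by split; apply/eqP; ring.
Qed.

Lemma expi_subN (t : R) : expi t - expi (- t) = 2 * 'i * (sin (2 * pi * t))%:C.
Proof.
apply/eqP; rewrite eq_complex /expi mulrN cosN sinN /=; apply/andP.
by split; apply/eqP; ring.
Qed.

End Expi.

(** * Basis states as bit assignments, and registers as lists of qubits *)

Lemma modn_bit_double (b : bool) (x M : nat) : (0 < M)%N ->
  ((b + 2 * x) %% (2 * M) = b + 2 * (x %% M))%N.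
Proof.
move=> M_gt0; rewrite {1}(divn_eq x M).
rewrite (_ : (_ + _ = x %/ M * (2 * M) + (b + 2 * (x %% M)))%N); last by ring.
rewrite modnMDl modn_small //.
by have := ltn_pmod x M_gt0; case: b => /=; lia.
Qed.

Section States.
Variable m : nat.
Notation state := {ffun 'I_m -> bool}.
Implicit Types (b : state) (q t : 'I_m) (qs : seq 'I_m).

Definition upd b q (v : bool) : state := [ffun k => if k == q then v else b k].

Lemma updE b q v k : upd b q v k = if k == q then v else b k.
Proof. by rewrite ffunE. Qed.

Lemma upd_id b q : upd b q (b q) = b.
Proof. by apply/ffunP=> k; rewrite updE; case: eqP => // ->. Qed.

Lemma upd_upd b q v w : upd (upd b q v) q w = upd b q w.
Proof. by apply/ffunP=> k; rewrite !updE; case: eqP. Qed.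

Lemma updC b q t v w : q != t -> upd (upd b q v) t w = upd (upd b t w) q v.
Proof.
move=> qt; apply/ffunP=> k; rewrite !updE; case: eqP => // ->.
by rewrite eq_sym (negbTE qt).
Qed.

(* The head of the list is the least significant qubit of the register. *)
Fixpoint regval qs b : nat :=
  if qs is q :: qs' then (b q + 2 * regval qs' b)%N else 0.

(** Bits of [y] beyond the length of the register are dropped, so writing is implicitly modulo
    [2 ^ size qs]. *)
Fixpoint regset qs (y : nat) b : state :=
  if qs is q :: qs' then regset qs' y./2 (upd b q (odd y)) else b.

Lemma regset_out qs y b k : k \notin qs -> regset qs y b k = b k.
Proof.
elim: qs y b => //= q qs IHqs y b; rewrite inE negb_or => /andP[kq kqs].
by rewrite IHqs // updE (negbTE kq).
Qed.

Lemma eq_regset qs y b b' :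
  (forall k, k \notin qs -> b k = b' k) -> regset qs y b = regset qs y b'.
Proof.
elim: qs y b b' => [|q qs IHqs] y b b' /= eqb; first by apply/ffunP=> k; exact: eqb.
apply: IHqs => k kqs; rewrite !updE; case: (k =P q) => // /eqP kq.
by apply: eqb; rewrite inE negb_or kq.
Qed.

Lemma regset_regset qs y z b : regset qs y (regset qs z b) = regset qs y b.
Proof. by apply: eq_regset => k kqs; rewrite regset_out. Qed.

Lemma eq_regval qs b b' : {in qs, b =1 b'} -> regval qs b = regval qs b'.
Proof.
elim: qs => //= q qs IHqs eqb; rewrite eqb ?mem_head // IHqs // => k kqs.
by rewrite eqb // inE kqs orbT.
Qed.

(** The parity of the value determines the head bit, and its half the other bits. *)
Lemma regval_inj qs b b' : regval qs b = regval qs b' -> {in qs, b =1 b'}.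
Proof.
elim: qs => //= q qs IHqs eqr k; have eqq : b q = b' q.
  by move: eqr; case: (b q) (b' q) => -[] /=; lia.
rewrite inE => /orP[/eqP-> // | kqs]; apply: IHqs kqs.
by move: eqr; rewrite eqq; lia.
Qed.

Lemma regval_upd qs b q v : q \notin qs -> regval qs (upd b q v) = regval qs b.
Proof.
move=> qqs; apply: eq_regval => k kqs; rewrite updE; case: eqP => // kq.
by rewrite -kq kqs in qqs.
Qed.

Lemma regset_upd qs y b q v : q \notin qs ->
  regset qs y (upd b q v) = upd (regset qs y b) q v.
Proof.
elim: qs y b => //= p qs IHqs y b; rewrite inE negb_or => /andP[qp qqs].
by rewrite updC // IHqs.
Qed.

Lemma regval_lt qs b : (regval qs b < 2 ^ size qs)%N.
Proof. by elim: qs => //= q qs IHqs; rewrite expnS; case: (b q) => /=; lia. Qed.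

Lemma regvalK qs b : uniq qs -> regset qs (regval qs b) b = b.
Proof.
elim: qs b => //= q qs IHqs b /andP[qqs uqs].
by rewrite mul2n half_bit_double oddD odd_double addbF oddb upd_id IHqs.
Qed.

Lemma regsetK qs y b : uniq qs -> regval qs (regset qs y b) = (y %% 2 ^ size qs)%N.
Proof.
elim: qs y b => [|q qs IHqs] y b /=; first by rewrite expn0 modn1.
move=> /andP[qqs uqs]; rewrite IHqs // regset_out // updE eqxx expnS.
by rewrite -modn_bit_double ?expn_gt0 // mul2n odd_double_half.
Qed.

Lemma regval_rcons qs q b :
  regval (rcons qs q) b = (regval qs b + 2 ^ size qs * b q)%N.
Proof. by elim: qs => [|p qs IHqs] /=; rewrite ?IHqs ?expnS; lia. Qed.

Lemma regset_rcons qs q y b :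
  regset (rcons qs q) y b = upd (regset qs y b) q (odd (y %/ 2 ^ size qs)).
Proof.
elim: qs y b => [|p qs IHqs] y b /=; first by rewrite expn0 divn1.
by rewrite IHqs -divn2 -divnMA expnS.
Qed.

Lemma regset_mod qs y b : regset qs (y %% 2 ^ size qs)%N b = regset qs y b.
Proof.
elim: qs y b => //= q qs IHqs y b.
have M_gt0 : (0 < 2 ^ size qs)%N by rewrite expn_gt0.
rewrite -{1 2}(odd_double_half y) -mul2n expnS modn_bit_double //.
by rewrite mul2n half_bit_double IHqs oddD odd_double addbF; case: (odd y).
Qed.

End States.

(** * Action of circuits on amplitudes, and its agreement with the matrices *)

Section Action.
Variables (R : realType) (m : nat).
Notation C := (R[i]).
Notation state := {ffun 'I_m -> bool}.
Implicit Types (b : state) (g : gate R m) (gs : seq (gate R m)).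
Implicit Types (psi : state -> C).

(** The new amplitude at [b] is collected from the states that are sent to [b]. A valid CNOT is its
    own inverse, so it acts by precomposition with its own bit flip. *)
Definition gate_act g psi : state -> C :=
  match g with
  | CNOT c t => fun b => psi (upd b t (b t (+) b c))
  | Single t U => fun b => \sum_(v : bool) U (b2I (b t)) (b2I v) * psi (upd b t v)
  end.

Definition act gs psi : state -> C := foldl (fun phi g => gate_act g phi) psi gs.

Lemma act_cat gs1 gs2 psi : act (gs1 ++ gs2) psi = act gs2 (act gs1 psi).
Proof. exact: foldl_cat. Qed.

Lemma act_seq1 g psi : act [:: g] psi = gate_act g psi.
Proof. by []. Qed.

Definition valid_circuit gs : Prop := forall g, List.In g gs -> valid_gate g.

Lemma valid_nil : valid_circuit [::].
Proof. by []. Qed.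

Lemma valid_cons g gs : valid_gate g -> valid_circuit gs -> valid_circuit (g :: gs).
Proof. by move=> vg vgs h /= [<- //|/vgs]. Qed.

Lemma valid_cat gs1 gs2 :
  valid_circuit gs1 -> valid_circuit gs2 -> valid_circuit (gs1 ++ gs2).
Proof.
move=> v1 v2; elim: gs1 v1 => //= g gs1 IHgs v1.
apply: valid_cons; first by apply: v1; left.
by apply: IHgs => h hgs; apply: v1; right.
Qed.

Definition inv_gate g : gate R m :=
  match g with CNOT c t => CNOT R c t | Single t U => Single t (adjmx U) end.

Definition inv_circuit gs := rev (map inv_gate gs).

Lemma adjmxK (U : 'M[C]_2) : adjmx (adjmx U) = U.
Proof. by apply/matrixP=> i j; rewrite !mxE conjcK. Qed.

Lemma valid_inv_circuit gs : valid_circuit gs -> valid_circuit (inv_circuit gs).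
Proof.
elim: gs => [|g gs IHgs] vgs //; rewrite /inv_circuit /= rev_cons -cats1.
apply: valid_cat; first by apply: IHgs => h hgs; apply: vgs; right.
apply: valid_cons => //; have: valid_gate g by apply: vgs; left.
by case: g {vgs} => //= t U; rewrite /unitary adjmxK => /mulmx1C.
Qed.

Lemma gate_actK g psi : valid_gate g -> gate_act (inv_gate g) (gate_act g psi) = psi.
Proof.
move=> vg; apply/funext => b; case: g vg => [c t /= /eqP ct|t U /= /mulmx1C vU].
  by rewrite !updE eqxx (negbTE ct) upd_upd addbK upd_id.
(* The two successive one-bit sums combine into entries of [adjmx U *m U], which is the identity. *)
transitivity (\sum_(w : bool) (adjmx U *m U) (b2I (b t)) (b2I w) * psi (upd b t w)).
  transitivity (\sum_(w : bool) \sum_(v : bool)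
     adjmx U (b2I (b t)) (b2I v) * U (b2I v) (b2I w) * psi (upd b t w)).
    rewrite exchange_big; apply: eq_bigr => v _; rewrite mulr_sumr.
    by apply: eq_bigr => w _; rewrite updE eqxx upd_upd mulrA.
  apply: eq_bigr => w _; rewrite -mulr_suml; congr (_ * _).
  rewrite mxE (reindex b2I) //; exists (fun i : 'I_2 => i == 1%N :> nat).
    by move=> [] _; rewrite /b2I inordK.
  by move=> [[|[|i]] lti] _ //; apply/val_inj; rewrite /= inordK.
rewrite vU (bigD1 (b t)) //= mxE eqxx mul1r upd_id big1 ?addr0 // => w wb.
rewrite mxE (_ : (b2I (b t) == b2I w) = false) ?mul0r //.
by apply/negbTE; apply: contra wb; rewrite -val_eqE /= !inordK ?ltnS ?leq_b1 //; case: w (b t) => -[].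
Qed.

Lemma act_invK gs psi : valid_circuit gs -> act (inv_circuit gs) (act gs psi) = psi.
Proof.
elim: gs psi => // g gs IHgs psi vgs.
rewrite /inv_circuit /= rev_cons -cats1 act_cat IHgs; last first.
  by move=> h hgs; apply: vgs; right.
by apply: gate_actK; apply: vgs; left.
Qed.

Definition bits (x : 'I_(2 ^ m)) : state := [ffun k : 'I_m => bit k x].

Lemma bits_inj : injective bits.
Proof.
(* Uniqueness of binary expansions of length [k], by stripping the lowest bit. *)
have inj k x y : (x < 2 ^ k)%N -> (y < 2 ^ k)%N ->
    (forall i, (i < k)%N -> bit i x = bit i y) -> x = y.
  elim: k x y => [|k IHk] x y; first by rewrite expn0 !ltnS !leqn0 => /eqP-> /eqP->.
  rewrite expnS => ltx lty eqb.
  have /IHk h : (x./2 < 2 ^ k)%N by lia.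
  have {}/h h : (y./2 < 2 ^ k)%N by lia.
  rewrite -(odd_double_half x) -(odd_double_half y).
  have := eqb 0 isT; rewrite /bit expn0 !divn1 => ->; congr (_ + _.*2)%N.
  apply: h => i lti; have := eqb i.+1 lti.
  by rewrite /bit expnS !divnMA !divn2.
move=> x y /ffunP eqxy; apply: val_inj; apply: (inj m); [exact: ltn_ord | exact: ltn_ord | move=> i lti].
by have := eqxy (Ordinal lti); rewrite !ffunE.
Qed.

Lemma bits_bij : bijective bits.
Proof.
by apply: inj_card_bij bits_inj _; rewrite card_ffun card_bool !card_ord.
Qed.

(** A gate on [t] couples only states that agree off [t]. There are two of them, so a row of its
    matrix collapses to a sum over one bit. *)
Lemma sum_two_states (b : state) t (F : state -> C) :
  \sum_(b' : state) (if [forall k, (k != t) ==> (b k == b' k)] then F b' else 0) =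
  \sum_(v : bool) F (upd b t v).
Proof.
rewrite -big_mkcond /= (reindex_onto (upd b t) (fun b' => b' t)) /=.
  apply: eq_bigl => v; rewrite updE eqxx eqxx andbT.
  by apply/forallP => k; apply/implyP => kt; rewrite updE (negbTE kt).
move=> b' /forallP eqb; apply/ffunP => k; rewrite updE.
by case: eqP => [-> //|/eqP kt]; have /implyP/(_ kt)/eqP := eqb k.
Qed.

Lemma gate_mx_act g psi (x : 'I_(2 ^ m)) : valid_gate g ->
  \sum_y gate_mx g x y * psi (bits y) = gate_act g psi (bits x).
Proof.
have bitsE (y : 'I_(2 ^ m)) (k : 'I_m) : bit k y = bits y k by rewrite ffunE.
case: g => [c t /= /eqP ct|t U _] /=.
  transitivity (\sum_(b : state)
    if [forall k, (k != t) ==> (bits x k == b k)]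
    then (if bits x t == b t (+) b c then psi b else 0) else 0).
    rewrite [RHS](reindex bits) /=; last exact/onW_bij/bits_bij.
    apply: eq_bigr => y _; rewrite mxE !bitsE.
    under eq_forallb do rewrite !bitsE.
    by case: forallP => _ /=; rewrite ?mul0r //; case: eqP; rewrite ?mul1r ?mul0r.
  rewrite sum_two_states big_bool !updE eqxx (negbTE ct).
  by case: (bits x t) (bits x c) => -[]; rewrite /= ?addr0 ?add0r.
transitivity (\sum_(b : state)
    if [forall k, (k != t) ==> (bits x k == b k)]
    then U (b2I (bits x t)) (b2I (b t)) * psi b else 0).
  rewrite [RHS](reindex bits) /=; last exact/onW_bij/bits_bij.
  apply: eq_bigr => y _; rewrite mxE !bitsE.
  under eq_forallb do rewrite !bitsE.
  by case: forallP => _ /=; rewrite ?mul0r.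
by rewrite sum_two_states; apply: eq_bigr => v _; rewrite updE eqxx.
Qed.

Lemma circuit_mx_act gs psi (x : 'I_(2 ^ m)) : valid_circuit gs ->
  \sum_y circuit_mx gs x y * psi (bits y) = act gs psi (bits x).
Proof.
elim: gs psi => [|g gs IHgs] psi vgs /=.
  rewrite (bigD1 x) //= mxE eqxx mul1r big1 ?addr0 // => y yx.
  by rewrite mxE eq_sym (negbTE yx) mul0r.
rewrite -IHgs; last by move=> h hgs; apply: vgs; right.
under [RHS]eq_bigr => y _.
  rewrite -gate_mx_act; last by apply: vgs; left.
  rewrite mulr_sumr; over.
rewrite exchange_big /=; apply: eq_bigr => z _; rewrite mxE mulr_suml.
by apply: eq_bigr => y _; rewrite mulrA.
Qed.

(** A column of the matrix is the image of a basis vector. Through this bridge, matrix entries are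
    computed as amplitudes in all that follows. *)
Lemma circuit_mxE gs (x y : 'I_(2 ^ m)) : valid_circuit gs ->
  circuit_mx gs x y = act gs (fun b => (b == bits y)%:R) (bits x).
Proof.
move=> vgs; rewrite -circuit_mx_act // (bigD1 y) //= eqxx mulr1 big1 ?addr0 //.
by move=> z zy; rewrite (inj_eq bits_inj) (negbTE zy) mulr0.
Qed.

End Action.

Arguments act {R m} gs psi _ : simpl never.

(** * Phase gates, permutations of qubits and the quantum Fourier transform *)

Section Circuits.
Variables (R : realType) (m : nat).
Notation C := (R[i]).
Notation state := {ffun 'I_m -> bool}.
Notation circuit := (seq (gate R m)).
Implicit Types (b : state) (q c t : 'I_m) (qs : seq 'I_m) (psi : state -> C).

(** Indexing a one-qubit matrix by booleans keeps ['I_2] out of the calculations. *)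
Definition single t (f : bool -> bool -> C) : gate R m :=
  Single t (\matrix_(i, j) f (i == 1%N :> nat) (j == 1%N :> nat)).

Lemma act_single t f psi :
  gate_act (single t f) psi = fun b => \sum_(v : bool) f (b t) v * psi (upd b t v).
Proof.
apply/funext => b /=; apply: eq_bigr => v _; rewrite mxE /b2I !inordK ?ltnS ?leq_b1 //.
by rewrite !eqb1.
Qed.

Lemma valid_single t (f : bool -> bool -> C) :
  (forall u v, \sum_(w : bool) f u w * conjc (f v w) = (u == v)%:R) ->
  valid_gate (single t f).
Proof.
move=> uf; apply/matrixP => i j; rewrite !mxE.
have -> : (i == j) = ((i == 1%N :> nat) == (j == 1%N :> nat)).
  by case: i j => [[|[|i]] lti] [[|[|j]] ltj].
by rewrite -uf big_bool !big_ord_recl big_ord0 !mxE /= addr0 addrC.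
Qed.

Definition rsqrt2 : C := ((Num.sqrt 2)^-1)%:C.

Lemma sqr_rsqrt2 : 2 * rsqrt2 ^+ 2 = 1.
Proof.
rewrite /rsqrt2 -rmorphXn exprVn sqr_sqrtr ?ler0n // -[2]/(2%:R) -(rmorph_nat (real_complex R)).
by rewrite -rmorphM divff ?pnatr_eq0.
Qed.

Definition hadamard (u v : bool) : C := rsqrt2 * (-1) ^+ (u && v).

Definition hgate t := single t hadamard.

Lemma valid_hgate t : valid_gate (hgate t).
Proof.
have conjH u v : conjc (hadamard u v) = hadamard u v.
  by rewrite /hadamard; case: (u && v); rewrite ?mulrN1 ?mulr1 ?rmorphN /= oppr0.
apply: valid_single => u v; rewrite big_bool !conjH /hadamard !andbT !andbF.
have := sqr_rsqrt2; rewrite mulr_natl expr2 mulr2n; move: rsqrt2 => r rE.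
by case: u v => -[]; rewrite /= ?expr1 ?expr0 ?mulr1 ?mulrN1 ?mulrN ?mulNr ?opprK
  ?rE ?subrr ?addNr.
Qed.

Lemma act_hgate t psi :
  gate_act (hgate t) psi = fun b => \sum_(v : bool) hadamard (b t) v * psi (upd b t v).
Proof. exact: act_single. Qed.

Definition phase t (a : R) :=
  single t (fun u v => if u == v then expi (u%:R * a) else 0).

Lemma valid_phase t a : valid_gate (phase t a).
Proof.
apply: valid_single => u v; rewrite big_bool !(fun_if (@conjc _)) conjc0 !conj_expi.
by case: u v => -[]; rewrite /= ?mul_expiN ?mulr0 ?mul0r ?add0r ?addr0.
Qed.

Lemma act_phase t a psi :
  gate_act (phase t a) psi = fun b => expi ((b t)%:R * a) * psi b.
Proof.
rewrite act_single; apply/funext => b; rewrite big_bool.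
by case: (b t) (upd_id b t) => /= ->; rewrite mul0r ?addr0 ?add0r ?mul0r.
Qed.

(** For bits, [u v = (u + v - (u xor v)) / 2]; the two CNOTs compute the exclusive or in [t] and
    erase it again around the third phase gate. *)
Definition cphase c t (a : R) : circuit :=
  [:: phase c (a / 2); phase t (a / 2); CNOT R c t; phase t (- (a / 2)); CNOT R c t].

Lemma valid_cphase c t a : c != t -> valid_circuit (cphase c t a).
Proof.
move=> /eqP ct.
by do 5!(apply: valid_cons; first by [exact: ct | exact: valid_phase]).
Qed.

Lemma act_cphase c t a psi : c != t ->
  act (cphase c t a) psi = fun b => expi ((b c && b t)%:R * a) * psi b.
Proof.
move=> ct; rewrite /act /foldl /cphase !act_phase; apply/funext => b /=.
rewrite !updE !eqxx (negbTE ct) upd_upd addbK upd_id mulrA mulrA -!expiD.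
by congr (expi _ * _); case: (b c) (b t) => -[] /=; field.
Qed.

(** Doubling the angle from qubit to qubit follows the binary weights, which makes the total phase
    linear in the register value. *)
Fixpoint phases qs (a : R) : circuit :=
  if qs is q :: qs' then phase q a :: phases qs' (2 * a) else [::].

Lemma size_phases qs a : size (phases qs a) = size qs.
Proof. by elim: qs a => //= q qs IHqs a; rewrite IHqs. Qed.

Lemma valid_phases qs a : valid_circuit (phases qs a).
Proof.
elim: qs a => [|q qs IHqs] a; first exact: valid_nil.
by apply: valid_cons; first exact: valid_phase.
Qed.

Lemma act_phases qs a psi :
  act (phases qs a) psi = fun b => expi ((regval qs b)%:R * a) * psi b.
Proof.
elim: qs a psi => [|q qs IHqs] a psi; apply/funext => b.
  by rewrite /= mul0r expi0 mul1r.
rewrite -[LHS]/(act (phases qs (2 * a)) (gate_act (phase q a) psi) b).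
rewrite IHqs act_phase mulrA -expiD; congr (expi _ * _).
by rewrite /= natrD natrM; ring.
Qed.

Fixpoint cphases c qs (a : R) : circuit :=
  if qs is q :: qs' then cphase c q a ++ cphases c qs' (2 * a) else [::].

Lemma size_cphases c qs a : size (cphases c qs a) = (5 * size qs)%N.
Proof. by elim: qs a => //= q qs IHqs a; rewrite IHqs; lia. Qed.

Lemma valid_cphases c qs a : c \notin qs -> valid_circuit (cphases c qs a).
Proof.
elim: qs a => [|q qs IHqs] a; first by move=> _; exact: valid_nil.
rewrite inE negb_or => /andP[cq cqs].
by apply: valid_cat; [exact: valid_cphase | exact: IHqs].
Qed.

Lemma act_cphases c qs a psi : c \notin qs ->
  act (cphases c qs a) psi = fun b => expi ((b c)%:R * (regval qs b)%:R * a) * psi b.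
Proof.
elim: qs a psi => [|q qs IHqs] a psi; first by move=> _; apply/funext => b; rewrite /= mulr0 mul0r expi0 mul1r.
rewrite inE negb_or => /andP[cq cqs].
rewrite -[LHS]/(act (cphase c q a ++ cphases c qs (2 * a)) psi).
rewrite act_cat IHqs // act_cphase //.
apply/funext => b; rewrite mulrA -expiD; congr (expi _ * _).
by rewrite natrD natrM; case: (b c) (b q) => -[] /=; ring.
Qed.

Definition swap q t : circuit := [:: CNOT R q t; CNOT R t q; CNOT R q t].

Definition swap_bits q t b : state := upd (upd b q (b t)) t (b q).

Lemma act_swap q t psi : q != t -> act (swap q t) psi = psi \o swap_bits q t.
Proof.
move=> qt; apply/funext => b; rewrite /act /= !updE !eqxx (negbTE qt) (eq_sym t q) (negbTE qt).
congr psi; apply/ffunP => k; rewrite !updE.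
by case: (k =P t) => _; case: (k =P q) => _ //; case: (b q) (b t) => -[].
Qed.

(* Moves the content of [q] to the most significant position of the register
   [q :: qs] and shifts all other qubits down by one position. *)
Fixpoint rotate q qs : circuit :=
  if qs is q' :: qs' then swap q q' ++ rotate q' qs' else [::].

Fixpoint rotate_bits q qs b : state :=
  if qs is q' :: qs' then swap_bits q q' (rotate_bits q' qs' b) else b.

Lemma size_rotate q qs : size (rotate q qs) = (3 * size qs)%N.
Proof. by elim: qs q => //= q' qs IHqs q; rewrite IHqs; lia. Qed.

Lemma valid_rotate q qs : uniq (q :: qs) -> valid_circuit (rotate q qs).
Proof.
elim: qs q => [|q' qs IHqs] q; first by move=> _; exact: valid_nil.
rewrite /= inE negb_or => /andP[/andP[/eqP qq' _] uqs].
by do 3!(apply: valid_cons; first by [exact: qq' | exact: nesym]); exact: IHqs.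
Qed.

Lemma act_rotate q qs psi : uniq (q :: qs) ->
  act (rotate q qs) psi = psi \o rotate_bits q qs.
Proof.
elim: qs q psi => // q' qs IHqs q psi.
rewrite /= inE negb_or => /andP[/andP[qq' _] uqs].
rewrite -[LHS]/(act (swap q q' ++ rotate q' qs) psi).
by rewrite act_cat IHqs // act_swap.
Qed.

Lemma rotate_bits_out q qs b k : k \notin q :: qs -> rotate_bits q qs b k = b k.
Proof.
elim: qs q => //= q' qs IHqs q; rewrite 2!inE !negb_or => /and3P[kq kq' kqs].
by rewrite !updE (negbTE kq) (negbTE kq') IHqs // inE negb_or kq' kqs.
Qed.

(** The state read before the rotation has its top bit in [q] and the lower bits in [qs], which is
    where the Hadamard step of [qft] leaves them. *)
Lemma regval_rotate_bits q qs b : uniq (q :: qs) ->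
  (regval qs (rotate_bits q qs b) + 2 ^ size qs * rotate_bits q qs b q =
   regval (q :: qs) b)%N.
Proof.
elim: qs q => [|q' qs IHqs] q; first by rewrite /= expn0; lia.
rewrite [uniq _]/= => /andP[qqs uqs]; have := IHqs _ uqs => {IHqs} /=.
have : q != q' by move: qqs; rewrite inE negb_or => /andP[].
rewrite -(rotate_bits_out b qqs); move: (rotate_bits q' qs b) => b1 qq' <-.
move: qqs uqs; rewrite inE negb_or /= => /andP[_ qqs] /andP[q'qs _].
by rewrite !regval_upd // !updE !eqxx (negbTE qq') expnS; ring.
Qed.

(** Cooley-Tukey recursion on the parity of the input index, held by [q]: transform the upper bits,
    multiply by the twiddle factors when [q] is 1, and combine with a Hadamard gate. The resulting
    bit is the most significant one of the output, hence the rotation. *)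
Fixpoint qft qs : circuit :=
  if qs is q :: qs' then
    qft qs' ++ cphases q qs' (2 ^+ (size qs').+1)^-1 ++ hgate q :: rotate q qs'
  else [::].

Lemma size_qft qs : (size (qft qs) <= 8 * size qs ^ 2)%N.
Proof.
elim: qs => // q qs IHqs; rewrite /= !size_cat /= size_cphases size_rotate.
by nia.
Qed.

Lemma valid_qft qs : uniq qs -> valid_circuit (qft qs).
Proof.
elim: qs => [|q qs IHqs]; first by move=> _; exact: valid_nil.
move=> /= /andP[qqs uqs]; apply: valid_cat; first exact: IHqs.
apply: valid_cat; first exact: valid_cphases.
by apply: valid_cons; [exact: valid_hgate | apply: valid_rotate; rewrite /= qqs].
Qed.

Lemma sum_even_odd n (F : nat -> C) :
  \sum_(z < 2 * n) F z = \sum_(v : bool) \sum_(y < n) F (v + 2 * y)%N.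
Proof.
rewrite big_bool /=; elim: n => [|n IHn]; first by rewrite muln0 !big_ord0 addr0.
rewrite (_ : (2 * n.+1 = (2 * n).+2)%N); last by lia.
rewrite !big_ord_recr /= IHn [RHS]addrACA -addrA; congr (_ + _).
by rewrite addrC add1n add0n.
Qed.

Lemma act_qft qs psi : uniq qs ->
  act (qft qs) psi = fun b => rsqrt2 ^+ size qs *
    \sum_(y < 2 ^ size qs)
      expi ((regval qs b)%:R * y%:R / (2 ^ size qs)%N%:R) * psi (regset qs y b).
Proof.
elim: qs psi => [|q qs IHqs] psi uqs; apply/funext => b.
  by rewrite /= big_ord_recl big_ord0 /= !mul0r expi0 expr0 !mul1r addr0.
have [qqs uqs'] : q \notin qs /\ uniq qs by move/andP: uqs.
rewrite [qft _]/= !act_cat -cat1s act_cat act_rotate // [act [:: _]]/act /foldl.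
rewrite act_single act_cphases // IHqs // /comp.
have := regval_rotate_bits b uqs.
have : forall k, k \notin q :: qs -> rotate_bits q qs b k = b k.
  by move=> k; exact: rotate_bits_out.
move: (rotate_bits q qs b) => b1 b1E <-; rewrite [size (_ :: _)]/= expnS.
(* The parity [v] of the summation index is the old content of [q], and its half [y] that of
   [qs]. *)
rewrite (sum_even_odd _ (fun z => expi (_ * z%:R / _) * psi (regset (q :: qs) z b))).
rewrite mulr_sumr; apply: eq_bigr => v _.
rewrite !mulr_sumr; apply: eq_bigr => y _.
rewrite updE eqxx regval_upd // exprS.
have -> : regset qs y (upd b1 q v) = regset (q :: qs) (v + 2 * y) b.
  rewrite /= mul2n half_bit_double oddD odd_double addbF oddb.
  apply: eq_regset => k kqs; rewrite !updE; case: eqP => // /eqP kq.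
  by apply: b1E; rewrite inE negb_or kq.
rewrite /hadamard /= -(expi_half_nat R).
move: (psi _) (regval qs b1) => p V; move: (b1 q) => u.
rewrite [LHS](_ : _ = rsqrt2 * rsqrt2 ^+ size qs * (expi ((u && v)%:R / 2) *
  expi (v%:R * V%:R / (2 * 2 ^+ size qs)) * expi (V%:R * y%:R / (2 ^ size qs)%:R) * p)).
2: by ring.
rewrite exprS; congr (_ * (_ * _)); rewrite -!expiD.
(* With [V] for the value of [qs], expanding [(V + 2 ^ n u) (v + 2 y) / 2 ^ (n + 1)] with
   [n = size qs] gives the exponent on the left plus the integer [u y]. *)
rewrite -[LHS](expiDn _ (u * y)); congr expi; rewrite !(natrD, natrM, natrX, exprS).
by case: u v => -[] /=; field; rewrite expf_neq0 // pnatr_eq0.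
Qed.

End Circuits.

(** * Modular addition and controlled negation *)

Section Shift.
Variables (R : realType) (m : nat).
Notation C := (R[i]).
Notation state := {ffun 'I_m -> bool}.
Notation circuit := (seq (gate R m)).
Implicit Types (b : state) (q c t : 'I_m) (qs : seq 'I_m) (psi : state -> C).

Lemma sum_shift_mod (M s : nat) (F : nat -> C) : (0 < M)%N ->
  \sum_(y < M) F ((y + s) %% M)%N = \sum_(y < M) F y.
Proof.
move=> M_gt0; pose h (y : 'I_M) := Ordinal (ltn_pmod (y + s) M_gt0).
rewrite [RHS](reindex_inj (h := h)) // => y z /(congr1 val) /= /eqP.
by rewrite eqn_modDr !modn_small // => /eqP /val_inj.
Qed.

(* Translations of Z/M are diagonalised by the Fourier transform. *)
Definition shift qs (diag : circuit) : circuit :=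
  qft R qs ++ diag ++ inv_circuit (qft R qs).

Lemma size_shift qs diag :
  (size (shift qs diag) <= 16 * size qs ^ 2 + size diag)%N.
Proof.
rewrite !size_cat size_rev size_map; have := size_qft R qs; lia.
Qed.

Lemma valid_shift qs diag :
  uniq qs -> valid_circuit diag -> valid_circuit (shift qs diag).
Proof.
move=> uqs vd; do 2?apply: valid_cat => //; first exact: valid_qft.
exact/valid_inv_circuit/valid_qft.
Qed.

(** The amount [s] may depend on qubits outside the register, so that controlled additions are
    covered; the last hypothesis excludes dependence on the register itself. *)
Lemma act_shift qs diag (s : state -> nat) psi : uniq qs ->
  (forall phi, act diag phi = fun b =>
     expi (- ((s b)%:R * (regval qs b)%:R / (2 ^ size qs)%N%:R)) * phi b) ->
  (forall y b, s (regset qs y b) = s b) ->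
  act (shift qs diag) psi = fun b => psi (regset qs (regval qs b + s b) b).
Proof.
move=> uqs diagE sE; set M := (2 ^ size qs)%N.
have M_gt0 : (0 < M)%N by rewrite expn_gt0.
(* Once the right side is written as the inverse transform of its own transform, two Fourier sums
   remain to be compared; they differ by a translation of the index. *)
rewrite !act_cat -[RHS](act_invK _ (@valid_qft R _ _ uqs)).
congr act; rewrite diagE !act_qft //; apply/funext => b.
rewrite mulrCA; congr (_ * _).
pose F y := expi ((regval qs b)%:R * y%:R / M%:R) * psi (regset qs y b).
rewrite -[\sum_(y < _) _]/(\sum_(y < M) F y) -(sum_shift_mod (s b)) // mulr_sumr.
apply: eq_bigr => y _; rewrite /F expi_mod // regset_mod regset_regset sE regsetK //.
rewrite modn_small // mulrA -expiD; congr (expi _ * _); rewrite natrD; ring.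
Qed.

(** Since amplitudes are pulled back, the argument of [psi] moves by [s] while basis vectors move by
    [- s]. *)
Definition add_const qs (s : nat) :=
  shift qs (phases qs (- (s%:R / (2 ^ size qs)%N%:R))).

Lemma size_add_const qs s : (size (add_const qs s) <= 16 * size qs ^ 2 + size qs)%N.
Proof. by rewrite (leq_trans (size_shift _ _)) // size_phases. Qed.

Lemma valid_add_const qs s : uniq qs -> valid_circuit (add_const qs s).
Proof. by move=> uqs; apply: valid_shift => //; exact: valid_phases. Qed.

Lemma act_add_const qs s psi : uniq qs ->
  act (add_const qs s) psi = fun b => psi (regset qs (regval qs b + s) b).
Proof.
move=> uqs; apply: (act_shift (s := fun=> s)) => // phi; rewrite act_phases.
by apply/funext => b; congr (expi _ * _); ring.
Qed.

Definition cnots c qs : circuit := [seq CNOT R c q | q <- qs].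

Definition cflip c qs b : state := [ffun k => b k (+) (b c && (k \in qs))].

Lemma valid_cnots c qs : c \notin qs -> valid_circuit (cnots c qs).
Proof.
elim: qs => [|q qs IHqs]; first by move=> _; exact: valid_nil.
rewrite inE negb_or => /andP[/eqP cq cqs].
by apply: valid_cons; [exact: cq | exact: IHqs].
Qed.

Lemma act_cnots c qs psi : uniq (c :: qs) ->
  act (cnots c qs) psi = psi \o cflip c qs.
Proof.
elim: qs psi => [|q qs IHqs] psi /=.
  by move=> _; apply/funext => b /=; congr psi; apply/ffunP=> k; rewrite ffunE andbF addbF.
rewrite inE negb_or => /andP[/andP[cq cqs] /andP[qqs uqs]].
rewrite -[LHS]/(act (cnots c qs) (gate_act (CNOT R c q) psi)) IHqs /= ?cqs //.
apply/funext => b /=; congr psi; apply/ffunP=> k.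
rewrite updE !ffunE (negbTE qqs) (negbTE cqs) !andbF !addbF inE.
by case: (k =P q) => [->|]; rewrite ?(negbTE qqs) ?andbT.
Qed.

Lemma regval_compl qs b b' :
  {in qs, forall k, b' k = ~~ b k} -> (regval qs b' + regval qs b = (2 ^ size qs).-1)%N.
Proof.
elim: qs => //= q qs IHqs bE.
have := IHqs (fun k kqs => bE k (@mem_behead _ (q :: qs) k kqs)).
rewrite bE ?mem_head // expnS.
have : (0 < 2 ^ size qs)%N by rewrite expn_gt0.
by case: (b q) => /=; lia.
Qed.

(* Two's complement negation: complement every bit and add one. *)
Definition cneg c qs : circuit :=
  shift qs (cphases c qs (- (2 ^ size qs)%N%:R^-1)) ++ cnots c qs.

Lemma size_cneg c qs : (size (cneg c qs) <= 16 * size qs ^ 2 + 6 * size qs)%N.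
Proof.
rewrite size_cat size_map; have := size_shift qs (cphases c qs (- (2 ^ size qs)%N%:R^-1)).
by rewrite size_cphases; lia.
Qed.

Lemma valid_cneg c qs : uniq (c :: qs) -> valid_circuit (cneg c qs).
Proof.
move=> /= /andP[cqs uqs]; apply: valid_cat; last exact: valid_cnots.
by apply: valid_shift => //; exact: valid_cphases.
Qed.

(** The complement of a value [x] is [2 ^ n - 1 - x], with [n = size qs]. For [x = 0] the value
    written is [2 ^ n], which [regset] truncates to 0. *)
Lemma act_cneg c qs psi : uniq (c :: qs) ->
  act (cneg c qs) psi = fun b =>
    psi (regset qs (if b c then 2 ^ size qs - regval qs b else regval qs b)%N b).
Proof.
move=> ucqs; have /andP[cqs uqs] := ucqs.
rewrite act_cat act_cnots // (act_shift (s := fun b => b c)) //; first last.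
- by move=> y b; rewrite regset_out.
- by move=> phi; rewrite act_cphases //; apply/funext => b; rewrite mulrN.
apply/funext => b /=; rewrite (@eq_regset _ _ _ (cflip c qs b) b); last first.
  by move=> k kqs; rewrite ffunE (negbTE kqs) andbF addbF.
congr (psi (regset _ _ _)); rewrite ffunE (negbTE cqs) andbF addbF.
case bc: (b c); last first.
  by rewrite addn0; apply: eq_regval => k _; rewrite ffunE bc addbF.
have : (regval qs (cflip c qs b) + regval qs b = (2 ^ size qs).-1)%N.
  by apply: regval_compl => k kqs; rewrite ffunE bc kqs addbT.
by have := regval_lt qs b; rewrite /=; lia.
Qed.

End Shift.

(** * The controlled Hadamard gate *)

Section ControlledHadamard.
Variables (R : realType) (m : nat).
Notation C := (R[i]).
Notation state := {ffun 'I_m -> bool}.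
Notation circuit := (seq (gate R m)).
Implicit Types (b : state) (q c t : 'I_m) (qs : seq 'I_m) (psi : state -> C).

(* Cosine and sine of pi / 8, for which the rotation by that angle conjugates
   diag (1, -1) to the Hadamard matrix. *)
Definition cos8 : R := Num.sqrt ((1 + (Num.sqrt 2)^-1) / 2).
Definition sin8 : R := Num.sqrt ((1 - (Num.sqrt 2)^-1) / 2).

(** These are the Pythagorean and double-angle identities, derived from the radicals alone. *)
Lemma rot8E : [/\ cos8 ^+ 2 + sin8 ^+ 2 = 1,
  cos8 ^+ 2 - sin8 ^+ 2 = (Num.sqrt 2)^-1 & 2 * (cos8 * sin8) = (Num.sqrt 2)^-1].
Proof.
rewrite /cos8 /sin8; set r := (Num.sqrt 2)^-1.
have r2 : r ^+ 2 = 1 / 2 by rewrite exprVn sqr_sqrtr ?ler0n // mul1r.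
have r0 : 0 <= r by rewrite invr_ge0 sqrtr_ge0.
have r1 : r <= 1 by nra.
have p1 : 0 <= (1 + r) / 2 by lra.
have p2 : 0 <= (1 - r) / 2 by lra.
split; rewrite ?sqr_sqrtr //; try by field.
(* Here [(1 - r ^ 2) / 4 = r ^ 2 / 4], because [r ^ 2 = 1 / 2]. *)
rewrite -sqrtrM // (_ : (1 + r) / 2 * _ = (r / 2) ^+ 2); last by lra.
by rewrite sqrtr_sqr ger0_norm; [field | lra].
Qed.

Definition rot8 (u v : bool) : C :=
  if u == v then cos8%:C else if u then sin8%:C else - sin8%:C.

(** A half turn of phase is the sign -1, so the middle part is a controlled diag (1, -1). The outer
    gates are a rotation and its transpose, which cancel when the control is 0. *)
Definition chad c t : circuit :=
  single t (fun u v => rot8 v u) :: cphase c t (1 / 2) ++ [:: single t rot8].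

Lemma rot8_rot8 u v : \sum_(w : bool) rot8 u w * rot8 v w = (u == v)%:R.
Proof.
have [E _ _] := rot8E; move/(congr1 (real_complex R)): E; rewrite rmorphD !rmorphXn rmorph1.
rewrite /= big_bool /rot8 => E.
by case: u v => -[] /=; rewrite -?[1%:R]/1 -?E; ring.
Qed.

Lemma rot8Z_rot8 u v :
  \sum_(w : bool) rot8 u w * (-1) ^+ w * rot8 v w = hadamard R u v.
Proof.
have [_ E1 E2] := rot8E.
rewrite /hadamard /rsqrt2 big_bool /rot8.
have {}E1 : ((Num.sqrt 2)^-1)%:C = cos8%:C ^+ 2 - sin8%:C ^+ 2 :> C.
  by rewrite -E1 rmorphB !rmorphXn.
have {}E2 : ((Num.sqrt 2)^-1)%:C = cos8%:C * sin8%:C + cos8%:C * sin8%:C :> C.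
  by rewrite -E2 mulr_natl mulr2n rmorphD rmorphM.
by case: u v => -[] /=; rewrite ?expr0 ?expr1;
  [rewrite E1 | rewrite E2 | rewrite E2 | rewrite E1]; ring.
Qed.

Lemma valid_chad c t : c != t -> valid_circuit (chad c t).
Proof.
have conjr u v : conjc (rot8 u v) = rot8 u v.
  by rewrite /rot8; case: eqP => _; case: u; rewrite ?rmorphN /= oppr0.
move=> ct; apply: valid_cons.
  apply: valid_single => u v; rewrite !big_bool !conjr.
  have := rot8_rot8 u v; rewrite big_bool => <-.
  by case: u v => -[]; rewrite /rot8 /=; ring.
apply: valid_cat; first exact: valid_cphase.
apply: valid_cons; last exact: valid_nil.
by apply: valid_single => u v; rewrite -rot8_rot8; apply: eq_bigr => w _; rewrite conjr.
Qed.

Lemma act_chad c t psi : c != t ->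
  act (chad c t) psi = fun b =>
    if b c then gate_act (hgate R t) psi b else psi b.
Proof.
move=> ct; rewrite /chad -cat1s !act_cat act_cphase //.
rewrite !act_seq1 !act_single; apply/funext => b.
(* The three factors merge into one kernel, equal to the Hadamard matrix or to the identity
   according to [b c]. *)
transitivity (\sum_(w : bool)
    (\sum_(v : bool) rot8 (b t) v * (-1) ^+ (b c && v) * rot8 w v) * psi (upd b t w)).
  under [RHS]eq_bigr do rewrite mulr_suml.
  rewrite exchange_big; apply: eq_bigr => v _.
  rewrite !updE eqxx (negbTE ct) !mulr_sumr; apply: eq_bigr => w _.
  by rewrite upd_upd mul1r expi_half_nat; ring.
case: (b c) => /=; first by apply: eq_bigr => w _; rewrite rot8Z_rot8.
under eq_bigr => w _.
  under eq_bigr do rewrite expr0 mulr1.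
  rewrite rot8_rot8; over.
rewrite (bigD1 (b t)) //= eqxx mul1r upd_id big1 ?addr0 // => w wb.
by rewrite eq_sym (negbTE wb) mul0r.
Qed.

End ControlledHadamard.

(** * The circuit and its amplitudes on basis vectors *)

Lemma oppn_mod N x : (x < N)%N -> ((N - x) %% N = if x == 0 then 0 else N - x)%N.
Proof.
by case: eqP => [-> _|x0 ltx]; [rewrite subn0 modnn | rewrite modn_small //; lia].
Qed.

(** Negation modulo [N] is an involution on residues. *)
Lemma oppn_mod_eq N x y : (x < N)%N -> (y < N)%N ->
  ((N - x) %% N == y)%N = (x == (N - y) %% N)%N.
Proof.
by move=> ltx lty; rewrite !oppn_mod //; case: (x =P 0%N); case: (y =P 0%N); lia.
Qed.

(* Amplitude at [z] of the Fourier transform of the basis vector [e_(N * s)]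
   if [v = 0], of [(e_v + (-1)^s e_(2N - v)) / sqrt 2] otherwise. *)
Definition fourier_amp (R : realType) (n : nat) (s : bool) (v z : nat) : R[i] :=
  if v == 0%N then rsqrt2 R ^+ n.+1 * (-1) ^+ (z * s)
  else rsqrt2 R ^+ n.+2 * (expi (z%:R * v%:R / (2 * 2 ^ n)%N%:R) +
         (-1) ^+ s * expi (- (z%:R * v%:R / (2 * 2 ^ n)%N%:R))).

Section Transform.
Variables (R : realType) (m : nat) (anc top : 'I_m) (xs : seq 'I_m).
Notation C := (R[i]).
Notation state := {ffun 'I_m -> bool}.
Notation circuit := (seq (gate R m)).
Notation n := (size xs).
Implicit Types (b : state) (psi : state -> C) (s t w : bool) (u v x y : nat).

Hypothesis uniq_qubits : uniq [:: anc, top & xs].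
Hypothesis all_qubits : forall k, k \in [:: anc, top & xs].

Let anc_top : anc != top.
Proof. by move: uniq_qubits; rewrite /= inE negb_or => /andP[/andP[]]. Qed.
Let anc_xs : anc \notin xs.
Proof. by move: uniq_qubits; rewrite /= inE negb_or => /andP[/andP[]]. Qed.
Let top_xs : top \notin xs.
Proof. by move: uniq_qubits; rewrite /= => /and3P[]. Qed.
Let uniq_xs : uniq xs.
Proof. by move: uniq_qubits; rewrite /= => /and3P[]. Qed.
Let uniq_xsa : uniq (rcons xs anc).
Proof. by rewrite rcons_uniq anc_xs. Qed.
Let uniq_xst : uniq (rcons xs top).
Proof. by rewrite rcons_uniq top_xs. Qed.
Let uniq_txs : uniq (top :: xs).
Proof. by rewrite /= top_xs. Qed.
Let top_xsa : top \notin rcons xs anc.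
Proof. by rewrite mem_rcons inE negb_or eq_sym anc_top. Qed.

(* Subtracting 1 from the register [xs] extended by the ancilla, which holds 0,
   borrows from the ancilla exactly when [xs] holds 0. *)
Definition butterfly : circuit :=
  hgate R top :: add_const R (rcons xs anc) 1 ++ chad R anc top
    ++ add_const R (rcons xs anc) (2 ^ n.+1).-1.

Lemma size_butterfly : (size butterfly <= 32 * n.+1 ^ 2 + 2 * n.+1 + 8)%N.
Proof.
rewrite -[butterfly]cat1s 3!size_cat [size (chad _ _ _)]/= [size [:: _]]/=.
have := size_add_const R (rcons xs anc) 1.
have := size_add_const R (rcons xs anc) (2 ^ n.+1).-1.
by rewrite !size_rcons; lia.
Qed.

Lemma valid_butterfly : valid_circuit butterfly.
Proof.
apply: valid_cons; first exact: valid_hgate.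
apply: valid_cat; first exact: valid_add_const.
by apply: valid_cat; [exact: valid_chad | exact: valid_add_const].
Qed.

Lemma hgateK psi : gate_act (hgate R top) (gate_act (hgate R top) psi) = psi.
Proof.
have := sqr_rsqrt2 R; rewrite mulr_natl expr2 mulr2n => rE.
rewrite !act_hgate; apply/funext => b; rewrite !big_bool !updE !eqxx !upd_upd.
rewrite /hadamard; case: (b top) (upd_id b top) => /= ->;
  by rewrite -[RHS]mul1r -[in RHS]rE; ring.
Qed.

(** The first Hadamard gate is unconditional and the controlled one undoes it on a borrow. Adding
    [2 ^ n.+1 - 1] subtracts 1 modulo [2 ^ n.+1]; the parity of the quotient is the ancilla bit
    afterwards. *)
Lemma act_butterfly psi b :
  act butterfly psi b =
    if odd ((regval (rcons xs anc) b + (2 ^ n.+1).-1) %/ 2 ^ n)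
    then psi b else gate_act (hgate R top) psi b.
Proof.
rewrite /butterfly -cat1s 3!act_cat act_seq1 !act_add_const // act_chad //.
rewrite -{3}(hgateK psi); move: (gate_act _ psi) => phi; set qs := rcons xs anc.
(* The two translations, by 1 and by -1, cancel. *)
have subK y c : regval qs c = y -> regset qs (regval qs (regset qs
    (y + (2 ^ n.+1).-1) c) + 1) (regset qs (y + (2 ^ n.+1).-1) c) = c.
  move=> <-; rewrite regset_regset regsetK // -regset_mod size_rcons modnDml.
  have N_gt0 : (0 < 2 ^ n.+1)%N by rewrite expn_gt0.
  rewrite -addnA addn1 prednK // modnDr modn_small ?regvalK //.
  by rewrite -(size_rcons xs anc) regval_lt.
rewrite {1}regset_rcons updE eqxx; case: ifP => _; last by rewrite subK.
rewrite !act_hgate; apply: eq_bigr => w _.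
rewrite regset_out // -!regset_upd // subK //.
by rewrite regval_upd.
Qed.

Lemma act_butterfly0 psi b : ~~ b anc ->
  act butterfly psi b =
    if regval xs b == 0%N then psi b else gate_act (hgate R top) psi b.
Proof.
move=> /negbTE b_anc; rewrite act_butterfly regval_rcons b_anc muln0 addn0.
have := regval_lt xs b; have: (0 < 2 ^ n)%N by rewrite expn_gt0.
move: (2 ^ n)%N (regval xs b) (expnS 2 n) => N x -> N_gt0 x_lt.
clear - N_gt0 x_lt.
case: eqP => [->|/eqP x_neq0].
  (* For [x = 0] the quotient by [N] is 1: a borrow. For [x > 0] it is 2, and the ancilla stays
     0. *)
  rewrite (_ : (0 + (2 * N).-1 = 1 * N + N.-1)%N); last by lia.
  by rewrite divnMDl // divn_small // prednK.
rewrite (_ : (x + (2 * N).-1 = 2 * N + x.-1)%N); last by lia.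
by rewrite divnMDl // divn_small //; lia.
Qed.

(** The net effect never changes the ancilla, because the borrow is uncomputed; this is how the
    ancilla returns to 0. *)
Lemma act_butterfly_supp psi : (forall b, b anc -> psi b = 0) ->
  forall b, b anc -> act butterfly psi b = 0.
Proof.
move=> psi0 b b_anc; rewrite act_butterfly psi0 // act_hgate.
rewrite big1 ?if_same // => w _.
by rewrite psi0 ?mulr0 // updE (negbTE anc_top).
Qed.

(** The last two pieces realize the inverse of the first two: each is an involution, so only their
    order is reversed. *)
Definition dct_dst_circuit : circuit :=
  butterfly ++ cneg R top xs ++ qft R (rcons xs top) ++ cneg R top xs ++ butterfly.

Lemma size_dct_dst_circuit : (0 < n)%N -> (size dct_dst_circuit <= 1000 * n ^ 2)%N.
Proof.
(* Since [n + 1 <= 2 n], the pieces add up to at most [356 n ^ 2]; 1000 is a generous round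
   constant. *)
move=> n_gt0; rewrite 4!size_cat; have := size_butterfly.
have := size_cneg R top xs; have := size_qft R (rcons xs top).
by rewrite size_rcons; nia.
Qed.

Lemma valid_dct_dst_circuit : valid_circuit dct_dst_circuit.
Proof.
have v1 := valid_butterfly; have v2 : valid_circuit (cneg R top xs) by exact: valid_cneg.
by do 4!(apply: valid_cat; first by [exact: v1 | exact: v2 | exact: valid_qft]).
Qed.

Lemma act_dct_dst_supp psi : (forall b, b anc -> psi b = 0) ->
  forall b, b anc -> act dct_dst_circuit psi b = 0.
Proof.
move=> psi0; rewrite 4!act_cat; apply: act_butterfly_supp => b b_anc.
rewrite act_cneg // act_qft // act_cneg // big1 ?mulr0 // => y _.
rewrite act_butterfly_supp ?mulr0 // regset_out // regset_out; last first.
  by rewrite mem_rcons inE negb_or anc_top.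
by rewrite regset_out.
Qed.

(** Coordinates on the data space: [t] is the top bit and [x] the low part of the index, so [b]
    supplies only the ancilla. *)
Definition amp psi b t x : C := psi (upd (regset xs x b) top t).

Lemma amp_id psi b : psi b = amp psi b (b top) (regval xs b).
Proof. by rewrite /amp regvalK // upd_id. Qed.

Let N := (2 ^ n)%N.
Let N_gt0 : (0 < N)%N. Proof. by rewrite expn_gt0. Qed.

Section Amplitudes.
Variable b : state.
Hypothesis b_anc : ~~ b anc.

Let upd_anc x t : ~~ upd (regset xs x b) top t anc.
Proof. by rewrite updE (negbTE anc_top) regset_out. Qed.

Let upd_val x t : (x < N)%N -> regval xs (upd (regset xs x b) top t) = x.
Proof. by move=> ltx; rewrite regval_upd // regsetK // modn_small. Qed.

Lemma amp_butterfly psi t x : (x < N)%N ->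
  amp (act butterfly psi) b t x =
  if x == 0%N then amp psi b t x else \sum_w hadamard R t w * amp psi b w x.
Proof.
move=> ltx; rewrite {1}/amp act_butterfly0 // upd_val //.
case: eqP => // _; rewrite act_hgate.
by apply: eq_bigr => w _; rewrite updE eqxx upd_upd.
Qed.

Lemma amp_cneg psi t x : (x < N)%N ->
  amp (act (cneg R top xs) psi) b t x = amp psi b t (if t then (N - x) %% N else x)%N.
Proof.
move=> ltx; rewrite {1}/amp act_cneg // updE eqxx upd_val // regset_upd //.
by rewrite regset_regset /amp; case: t; rewrite // regset_mod.
Qed.

Lemma amp_qft psi t x : (x < N)%N ->
  amp (act (qft R (rcons xs top)) psi) b t x =
  rsqrt2 R ^+ n.+1 * \sum_(w : bool) \sum_(y < N)
    expi ((x + N * t)%N%:R * (y + N * w)%N%:R / (2 * N)%N%:R) * amp psi b w y.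
Proof.
move=> ltx; rewrite {1}/amp act_qft // size_rcons; congr (_ * _).
(* The qubit [top] is the most significant one of [rcons xs top], so an index [z < 2N] splits into
   the top bit [z / N] and the low part [z mod N]. *)
pose F z := expi ((x + N * t)%N%:R * z%:R / (2 * N)%N%:R) *
   amp psi b (odd (z %/ N)) (z %% N).
transitivity (\sum_(z < N + N) F z).
  rewrite addnn -mul2n -expnS; apply: eq_bigr => z _; rewrite /F -expnS.
  congr (expi (_%:R * _ / _) * _); first by rewrite regval_rcons upd_val // updE eqxx.
  rewrite regset_rcons regset_upd // upd_upd regset_regset /amp.
  by rewrite regset_mod.
rewrite big_split_ord big_bool /= addrC; congr (_ + _); apply: eq_bigr => y _.
  rewrite /F muln1 [(N + y)%N]addnC; congr (_ * amp _ _ _ _).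
    by rewrite divnDr // divnn N_gt0 divn_small.
  by rewrite modnDr modn_small.
by rewrite /F muln0 addn0 divn_small ?modn_small.
Qed.

Lemma state_eq b1 b2 : b1 anc = b2 anc -> b1 top = b2 top ->
  regval xs b1 = regval xs b2 -> b1 = b2.
Proof.
move=> eqa eqt /regval_inj eqx; apply/ffunP => k.
by have := all_qubits k; rewrite !inE => /or3P[/eqP-> | /eqP-> | /eqx].
Qed.

Lemma amp_delta b0 t x : ~~ b0 anc -> (x < N)%N ->
  amp (fun b' => (b' == b0)%:R) b t x = ((t == b0 top) && (x == regval xs b0))%:R.
Proof.
move=> b0_anc ltx; rewrite /amp; congr (nat_of_bool _)%:R.
apply/eqP/andP => [<-|[/eqP eqt /eqP eqx]]; first by rewrite updE eqxx upd_val.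
apply: state_eq; last by rewrite upd_val.
  by rewrite (negbTE (upd_anc _ _)) (negbTE b0_anc).
by rewrite updE eqxx.
Qed.

(** This is the column of T at [b0]: the low part [N - v] in the upper half is the index [2N - v],
    the partner of [v]. *)
Lemma amp_cneg_butterfly_delta b0 t x : ~~ b0 anc -> (x < N)%N ->
  amp (act (cneg R top xs) (act butterfly (fun b' => (b' == b0)%:R))) b t x =
  if regval xs b0 == 0%N then ((t == b0 top) && (x == 0%N))%:R
  else hadamard R t (b0 top) *
    (x == if t then N - regval xs b0 else regval xs b0)%N%:R.
Proof.
move=> b0_anc ltx; rewrite amp_cneg //.
have lty : ((if t then (N - x) %% N else x) < N)%N by case: t; rewrite ?ltn_pmod.
rewrite amp_butterfly // amp_delta //.
under eq_bigr do rewrite amp_delta //.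
have := regval_lt xs b0; rewrite -/N; move: (regval xs b0) => v ltv.
have eqE : ((if t then (N - x) %% N else x) == v)%N =
    (x == if t then (N - v) %% N else v)%N by case: t {lty}; rewrite // oppn_mod_eq.
rewrite (bigD1 (b0 top)) //= big1 ?addr0; last first.
  by move=> w /negbTE->; rewrite mulr0.
rewrite eqxx /=; case: (v =P 0%N) eqE => [-> eqE|v0 eqE].
  rewrite eqE subn0 modnn if_same; case: eqP => //.
  by rewrite andbF mulr0.
rewrite (_ : (if t then N - v else v) = if t then (N - v) %% N else v)%N; last first.
  by rewrite oppn_mod // (introF eqP v0).
rewrite -eqE; case: eqP => // ->.
by rewrite [(0%N == v)]eq_sym (introF eqP v0) andbF mulr0.
Qed.

Lemma amp_fourier b0 t x : ~~ b0 anc -> (x < N)%N ->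
  amp (act (qft R (rcons xs top)) (act (cneg R top xs)
    (act butterfly (fun b' => (b' == b0)%:R)))) b t x =
  fourier_amp R n (b0 top) (regval xs b0) (x + N * t).
Proof.
move=> b0_anc ltx; rewrite amp_qft //.
under eq_bigr => w _ do under eq_bigr => y _ do rewrite amp_cneg_butterfly_delta //.
rewrite /fourier_amp -/N; have := regval_lt xs b0; rewrite -/N.
have N_neq0 : N%:R != 0 :> R by rewrite pnatr_eq0 -lt0n.
move: (regval xs b0) (b0 top) (x + N * t)%N => v s z ltv.
case: eqP => v0.
  congr (_ * _); rewrite (bigD1 s) //= (bigD1 (Ordinal N_gt0)) //= !eqxx mulr1.
  rewrite !big1 ?addr0; first last.
  - by move=> y; rewrite -val_eqE /= => /negbTE->; rewrite mulr0.
  - by move=> w /negbTE->; rewrite big1 // => y _; rewrite mulr0.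
  rewrite -(expi_half_nat R) add0n !natrM; congr expi; by field.
rewrite [in RHS]exprSr -[RHS]mulrA; congr (_ * _).
have sumE w c : (c < N)%N -> \sum_(y < N)
    expi (z%:R * (y + N * w)%:R / (2 * N)%:R) * (hadamard R w s * ((y : nat) == c)%:R) =
    expi (z%:R * (c + N * w)%:R / (2 * N)%:R) * hadamard R w s.
  move=> ltc; rewrite (bigD1 (Ordinal ltc)) //= eqxx mulr1 big1 ?addr0 // => y.
  by rewrite -val_eqE /= => /negbTE->; rewrite !mulr0.
have ltNv : (N - v < N)%N by rewrite ltn_subrL N_gt0 lt0n andbT; exact/eqP.
rewrite big_bool /= !sumE //.
rewrite /hadamard /= expr0 mulr1 muln0 addn0 muln1.
(* The index [2N - v] gives the phase of [- v] up to [z] whole turns. *)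
rewrite (_ : z%:R * (N - v + N)%:R / (2 * N)%:R =
   - (z%:R * v%:R / (2 * N)%:R) + z%:R); last first.
  by rewrite natrD natrB 1?ltnW // natrM; field.
by rewrite expiDn; ring.
Qed.

Lemma act_dct_dst_delta b0 : ~~ b0 anc ->
  let A := fourier_amp R n (b0 top) (regval xs b0) in
  let u := regval xs b in
  act dct_dst_circuit (fun b' => (b' == b0)%:R) b =
  if u == 0%N then A (N * b top)%N
  else \sum_(w : bool) hadamard R (b top) w * A (if w then 2 * N - u else u)%N.
Proof.
move=> b0_anc A u; rewrite 4!act_cat amp_id; have ltu : (u < N)%N := regval_lt xs b.
rewrite amp_butterfly // -/u; case: eqP => u0.
  rewrite amp_cneg // u0 subn0 modnn if_same amp_fourier //.
apply: eq_bigr => w _; congr (_ * _); rewrite amp_cneg //.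
have ltNu : (N - u < N)%N by rewrite ltn_subrL N_gt0 lt0n andbT; exact/eqP.
rewrite modn_small // amp_fourier //; last by case: w.
(* For [w = true] the amplitude is read in the upper half, at [(N - u) + N = 2N - u]. *)
rewrite /A; case: w; rewrite /= ?muln0 ?addn0 // muln1 mul2n -addnn addnBAC //.
exact: ltnW.
Qed.

End Amplitudes.
End Transform.

(** * Comparison with the entries of the cosine and sine transforms *)

Section Entries.
Variables (R : realType) (n : nat).
Notation C := (R[i]).
Notation N := (2 ^ n)%N.
Implicit Types (s t : bool) (u v x y : nat).

Let N_neq0 : N%:R != 0 :> R.
Proof. by rewrite pnatr_eq0 -lt0n expn_gt0. Qed.

(** The Fourier transform preserves evenness and oddness under negation of the index. This parity
    makes the mixed entries between inner rows and columns vanish. *)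
Lemma fourier_amp_reflect s v u : (u <= 2 * N)%N ->
  fourier_amp R n s v (2 * N - u) =
  (-1) ^+ (s && (v != 0%N)) * fourier_amp R n s v u.
Proof.
move=> leu; rewrite /fourier_amp; case: eqP => _.
  rewrite andbF expr0 mul1r -signr_odd -[in RHS]signr_odd.
  by rewrite !oddM oddB // mul2n odd_double.
rewrite andbT (_ : (2 * N - u)%:R * v%:R / _ = - (u%:R * v%:R / (2 * N)%:R) + v%:R).
  rewrite expiDn opprD opprK -(expiDn (_ - _) v) subrK.
  by case: s; rewrite /= ?expr1 ?expr0; ring.
by rewrite natrB // natrM; field.
Qed.

(** Matches the normalisation of the transforms with the factors collected from Hadamard gates. *)
Lemma sqrt_2divN : (Num.sqrt (2 / N%:R))%:C = 2 * rsqrt2 R ^+ n.+1 :> C.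
Proof.
rewrite /rsqrt2 -rmorphXn -(rmorph_nat (real_complex R)) -rmorphM; congr (_ %:C).
have r0 : 0 <= (Num.sqrt 2)^-1 :> R by rewrite invr_ge0 sqrtr_ge0.
rewrite -[RHS]ger0_norm ?mulr_ge0 ?exprn_ge0 // -sqrtr_sqr; congr Num.sqrt.
rewrite exprMn -exprM mulnC exprM exprVn sqr_sqrtr ?ler0n // exprVn [2 ^+ n.+1]exprS.
by rewrite natrX; field; rewrite expf_neq0 ?pnatr_eq0.
Qed.

Lemma cos_natpi k : (cos (k%:R * pi))%:C = (-1) ^+ k :> C.
Proof.
elim: k => [|k IHk]; first by rewrite mul0r cos0.
by rewrite -natr1 mulrDl mul1r cosDpi rmorphN /= IHk exprS mulN1r.
Qed.

Lemma sin_natpi k : sin (k%:R * pi) = 0 :> R.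
Proof.
elim: k => [|k IHk]; first by rewrite mul0r sin0.
by rewrite -natr1 mulrDl mul1r sinDpi IHk oppr0.
Qed.

Lemma fourier_amp_cos v z : v != 0%N ->
  fourier_amp R n false v z =
  2 * rsqrt2 R ^+ n.+2 * (cos ((z * v)%N%:R * pi / N%:R))%:C.
Proof.
move=> /negbTE v0; rewrite /fourier_amp v0 expr0 mul1r expi_addN.
rewrite (_ : 2 * pi * _ = (z * v)%N%:R * pi / N%:R); first by ring.
by rewrite !natrM; field.
Qed.

(** A difference of conjugate exponentials is the source of the factor ['i] before the sine
    transform. *)
Lemma fourier_amp_sin v z : v != 0%N ->
  fourier_amp R n true v z =
  2 * rsqrt2 R ^+ n.+2 * ('i * (sin ((z * v)%N%:R * pi / N%:R))%:C).
Proof.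
move=> /negbTE v0; rewrite /fourier_amp v0 expr1 mulN1r expi_subN.
rewrite (_ : 2 * pi * _ = (z * v)%N%:R * pi / N%:R); first by ring.
by rewrite !natrM; field.
Qed.

Lemma DCT_DSTE (x y : 'I_(2 ^ n.+1)) :
  DCT_DST R n x y =
  if (x <= N)%N then
    if (y <= N)%N then
      (Num.sqrt (2 / N%:R) * kI R N x * kI R N y
        * cos ((x * y)%N%:R * pi / N%:R))%:C
    else 0
  else if (y <= N)%N then 0
  else 'i * (Num.sqrt (2 / N%:R) * sin (((x - N) * (y - N))%N%:R * pi / N%:R))%:C.
Proof.
rewrite /DCT_DST castmxE /block_mx mxE; case: splitP => x' /= xE.
  rewrite mxE; have -> : (x <= N)%N by rewrite xE -ltnS.
  case: splitP => y' /= yE; rewrite !mxE.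
    have -> : (y <= N)%N by rewrite yE -ltnS.
    by rewrite xE yE.
  by rewrite leqNgt yE addSn ltnS leq_addr.
rewrite mxE; have -> : (x <= N)%N = false.
  by rewrite leqNgt xE addSn ltnS leq_addr.
case: splitP => y' /= yE; rewrite !mxE /=.
  by have -> : (y <= N)%N by rewrite yE -ltnS.
have -> : (y <= N)%N = false by rewrite leqNgt yE addSn ltnS leq_addr.
(* The sine block starts at index [N + 1] and stores frequency 1 at position 0, so the frequency is
   [x - N]. *)
by rewrite xE yE !addSn -!addnS !addKn.
Qed.

Lemma dct_dst_entry (x y : 'I_(2 ^ n.+1)) s t u v : (u < N)%N -> (v < N)%N ->
  x = (u + N * t)%N :> nat -> y = (v + N * s)%N :> nat ->
  DCT_DST R n x y =
  if u == 0%N then fourier_amp R n s v (N * t)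
  else \sum_(w : bool) hadamard R t w * fourier_amp R n s v (if w then 2 * N - u else u)%N.
Proof.
move=> ltu ltv xE yE; rewrite DCT_DSTE.
have N_gt0 : (0 < N)%N by rewrite expn_gt0.
have kIE z : (kI R N z)%:C = if (z == 0%N) || (z == N) then rsqrt2 R else 1.
  by rewrite /kI; case: ifP.
(* The cosine block consists of the lower half and the single index [N], which has top bit 1 and low
   part 0. *)
have le_sum a (c : bool) : (a < N)%N -> (a + N * c <= N)%N = ~~ (c && (a != 0%N)).
  by case: c => /= ?; rewrite ?muln1 ?muln0 ?addn0; [case: eqP | apply: ltnW]; lia.
have k_sum a (c : bool) : (a < N)%N -> ~~ (c && (a != 0%N)) ->
    (kI R N (a + N * c))%:C = if a == 0%N then rsqrt2 R else 1.
  move=> lta; rewrite kIE; case: c => /=; rewrite ?muln1 ?muln0 ?addn0.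
    by rewrite negbK => /eqP->; rewrite add0n eqxx orbT.
  by move=> _; rewrite (ltn_eqF lta) orbF.
(* A neutral factor, used to balance powers of [rsqrt2]. *)
have rr a : a = 2 * rsqrt2 R * rsqrt2 R * a.
  by rewrite -[2 * _ * _]mulrA -expr2 sqr_rsqrt2 mul1r.
rewrite xE yE !le_sum // !(rmorphM (real_complex R)) /= sqrt_2divN.
case: (u =P 0%N) => [u0|/eqP u0]; case: (v =P 0%N) => [v0|/eqP v0].
- rewrite !k_sum ?u0 ?v0 ?andbF //= /fourier_amp eqxx !add0n.
  rewrite (_ : _ * pi / _ = (N * t * s)%:R * pi); last by rewrite !natrM; field.
  by rewrite cos_natpi [RHS]rr; ring.
(* Row 0 or [N] against an inner column: the sine vanishes at multiples of pi, and the cosine entry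
   carries one weight from [kI]. *)
- rewrite u0 andbF /= andbT; case: s {yE} => /=.
    rewrite fourier_amp_sin // (_ : _ * pi / _ = (t * v)%:R * pi).
      by rewrite sin_natpi !mulr0.
    by rewrite !natrM; field.
  rewrite (k_sum 0%N t) ?andbF // (k_sum v false) // (negbTE v0) eqxx add0n muln0 addn0 fourier_amp_cos //.
  by rewrite [_ ^+ n.+2]exprSr; ring.
- rewrite v0 andbF /= andbT big_bool /= fourier_amp_reflect; last by lia.
  rewrite eqxx andbF expr0 mul1r /hadamard andbF andbT; case: t {xE} => /=; first by ring.
  rewrite (k_sum 0%N s) ?andbF // (k_sum u false) // (negbTE u0) eqxx add0n muln0 addn0 /fourier_amp eqxx.
  rewrite (_ : _ * pi / _ = (u * s)%:R * pi); last by rewrite !natrM; field.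
  by rewrite cos_natpi; ring.
(* Row and column are both inner: by reflection the two terms cancel when [t] and [s] differ, and
   coincide when they agree. *)
rewrite big_bool /= fourier_amp_reflect; last by lia.
rewrite v0 !andbT /hadamard andbF andbT.
case: t s xE yE => -[] _ _ /=; last first.
- rewrite (k_sum u false) // (k_sum v false) // (negbTE u0) (negbTE v0) !muln0 !addn0 fourier_amp_cos //.
  by rewrite [LHS]rr [_ ^+ n.+2]exprSr; ring.
- by ring.
- by ring.
rewrite !muln1 !addnK fourier_amp_sin // [LHS]rr [_ ^+ n.+2]exprSr; ring.
Qed.

End Entries.

(** * The concrete qubits and the final assembly *)

Section Registers.
Variable n : nat.

(** The bound [n.+1 + 1] is convertible to [(n + 1).+1], the successor form that [inord] needs. *)
Definition qubit (k : nat) : 'I_(n.+1 + 1) := @inord (n + 1) k.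
Definition data_qubits := [seq qubit i | i <- iota 0 n].
Definition top_qubit := qubit n.
Definition anc_qubit := qubit n.+1.

Lemma val_qubit k : (k < n.+2)%N -> qubit k = k :> nat.
Proof. by move=> ltk; apply: (@inordK (n + 1)); rewrite addn1. Qed.

Lemma val_data_qubits : map val data_qubits = iota 0 n.
Proof.
rewrite -map_comp -[RHS]map_id; apply/eq_in_map => i; rewrite mem_iota => lti.
by rewrite /= val_qubit //; lia.
Qed.

Lemma size_data_qubits : size data_qubits = n.
Proof. by rewrite size_map size_iota. Qed.

Lemma uniq_qubits : uniq [:: anc_qubit, top_qubit & data_qubits].
Proof.
rewrite -(map_inj_uniq val_inj) /= val_data_qubits !val_qubit // iota_uniq !inE !mem_iota; lia.
Qed.

Lemma all_qubits k : k \in [:: anc_qubit, top_qubit & data_qubits].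
Proof.
rewrite -(mem_map val_inj) /= val_data_qubits !val_qubit // !inE mem_iota; have := ltn_ord k; lia.
Qed.

Lemma regval_bits (x : 'I_(2 ^ (n.+1 + 1))) :
  regval data_qubits (bits x) = (x %% 2 ^ n)%N.
Proof.
(* Generalised to a window of [k] qubits starting at [j], for the induction on [k]. *)
suff E k j : (j + k <= n)%N ->
    regval [seq qubit i | i <- iota j k] (bits x) = ((x %/ 2 ^ j) %% 2 ^ k)%N.
  by rewrite E // divn1.
elim: k j => [|k IHk] j lejk; first by rewrite expn0 modn1.
rewrite /= IHk; last by lia.
rewrite ffunE val_qubit /bit; last by lia.
rewrite [(2 ^ j.+1)%N]expnSr [(2 ^ k.+1)%N]expnS divnMA -modn_bit_double ?expn_gt0 //.
by rewrite divn2 mul2n odd_double_half.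
Qed.

End Registers.

Theorem mainTheorem1 (R : realType) :
  exists (c A : nat), (0 < c)%N /\
    forall n : nat, (1 <= n)%N ->
      exists a : nat, (a <= A)%N /\
        exists gs : seq (gate R (n.+1 + a)),
          (forall g, Stdlib.Lists.List.In g gs -> valid_gate g) /\
          (size gs <= c * n ^ 2)%N /\
          @realizes R n.+1 a (DCT_DST R n) (circuit_mx gs).
Proof.
exists 1000%N, 1%N; split=> // n n_gt0; exists 1%N; split=> //.
pose xs := data_qubits n; pose anc := anc_qubit n; pose top := top_qubit n.
have sz : size xs = n := size_data_qubits n.
have U : uniq [:: anc, top & xs] := uniq_qubits n.
have ALL : forall k, k \in [:: anc, top & xs] := @all_qubits n.
have V : valid_circuit (dct_dst_circuit R anc top xs) by exact: valid_dct_dst_circuit.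
exists (dct_dst_circuit R anc top xs); split=> //; split.
  by have := @size_dct_dst_circuit R _ anc top xs; rewrite sz; apply.
have ancE (x : 'I_(2 ^ (n.+1 + 1))) : bits x anc = (2 ^ n.+1 <= x)%N.
  have ltx : (x < 2 * 2 ^ n.+1)%N by rewrite -expnS -[n.+2]addn1 ltn_ord.
  rewrite ffunE val_qubit // /bit; case: leqP => [lex|ltxN]; last by rewrite divn_small.
  rewrite -(subnK lex) divnDr // divnn expn_gt0 divn_small //.
  by rewrite ltn_subLR // addnn -mul2n.
(* Below [2 ^ n.+1] the quotient by [2 ^ n] is a single bit, the top qubit. *)
have topE (x : 'I_(2 ^ (n.+1 + 1))) : (x < 2 ^ n.+1)%N ->
    x = (x %% 2 ^ n + 2 ^ n * bits x top)%N :> nat.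
  move=> ltx; rewrite ffunE val_qubit // /bit {1}(divn_eq x (2 ^ n)) addnC mulnC.
  congr (_ + _ * _)%N.
  have : (x %/ 2 ^ n < 2)%N by rewrite ltn_divLR ?expn_gt0 // -expnS.
  by case: (x %/ 2 ^ n)%N => [|[]].
move=> j; split=> [i|x lex]; rewrite circuit_mxE //.
  have anc0 (k : 'I_(2 ^ n.+1)) : ~~ bits (widen_ord (pow_widen n.+1 1) k) anc.
    by rewrite ancE /= -ltnNge.
  rewrite act_dct_dst_delta // !sz !regval_bits; apply/esym.
  by apply: dct_dst_entry; rewrite ?ltn_pmod ?expn_gt0 //; apply: (topE (widen_ord _ _)) => /=.
(* Here [x] has ancilla 1, while the input basis vector has ancilla 0. *)
apply: act_dct_dst_supp; rewrite // ?ancE // => b b_anc.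
case: eqP => // bE; move: b_anc; rewrite bE ancE /= leqNgt.
by rewrite ltn_ord.
Qed.
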